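(* Let $\omega\in\{0,1\}^{\infty}$. If $\omega$ is either cofinal or anticofinal with $0^{\infty}$, then $\mathrm{Aut}(X_\omega)\cong\mathbb{Z}/2\mathbb{Z}$; otherwise the automorphism group $\mathrm{Aut}(X_\omega)$ is trivial.
   Context: $\{0,1\}^{\infty}$ is the set of infinite sequences $x_1x_2\ldots$ with $x_i\in\{0,1\}$; for $x\in\{0,1\}$ put $\overline{x}=1-x$; $0^\infty$ is the constant sequence $000\ldots$. Definition of $X_\omega$. For $\omega=x_1x_2\ldots\in\{0,1\}^\infty$ and $n\ge 1$ put $a_n^{\omega}=\sum_{i=1}^n x_i2^{i-1}-2^{n-1}$. The graph $X_\omega$ is undirected with vertex set $V_\omega=\mathbb{Z}$. Its edges are those of the disjoint union $\coprod_{n\ge 0}E^n_\omega$, where $E^0_\omega=\{(z,z+1):z\in\mathbb{Z}\}$ and, for $n\ge1$, $E^n_\omega=\{(2^nz-a_n^\omega,\,2^n(z+1)-a_n^\omega):z\in\mathbb{Z}\}$; in addition, if there is a vertex not incident to any edge of $\coprod_{n\ge 1}E^n_\omega$ (there is at most one such vertex), a loop is added at that vertex. The graph $X_\omega$ is $4$-regular (a loop counts twice). Two sequences $\omega=x_1x_2\ldots$ and $\omega'=y_1y_2\ldots$ are cofinal (resp. anticofinal) if there exists $i_0$ such that $x_i=y_i$ (resp. $x_i=\overline{y}_i$) for every $i\ge i_0$. $\mathrm{Aut}(X)$ is the group of graph automorphisms of $X$, i.e. bijections of the vertex set preserving and reflecting adjacency (loops included). *)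

(* Defs.v *)
From HB Require Import structures.
From mathcomp Require Import all_boot all_order all_algebra all_fingroup.
From mathcomp Require Import boolp.

Set Implicit Arguments.
Unset Strict Implicit.
Unset Printing Implicit Defensive.

Import GRing.Theory.

(* Undirected graphs without parallel edges; loops are allowed. *)
Record graph := Graph {
  vertex :> Type;
  adj : vertex -> vertex -> Prop;
  adj_sym : forall u v, adj u v -> adj v u
}.

Record graph_aut (X : graph) := GraphAut {
  aut_fun :> X -> X;
  aut_bij : bijective aut_fun;
  aut_adj : forall u v : X, adj (aut_fun u) (aut_fun v) <-> adj u v
}.

Section AutGroup.
Variable X : graph.

Lemma graph_aut_inj (f g : graph_aut X) : f =1 g -> f = g.
Proof.
case: f g => [f fb fa] [g gb ga] /= /funext fg; subst g.
by congr GraphAut; apply: Prop_irrelevance.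
Qed.

HB.instance Definition _ := gen_eqMixin (graph_aut X).
HB.instance Definition _ := gen_choiceMixin (graph_aut X).

Definition aut_one : graph_aut X :=
  @GraphAut X id (Bijective (fun=> erefl) (fun=> erefl)) (fun u v => iff_refl _).

Lemma aut_mul_adj (f g : graph_aut X) (u v : X) :
  adj ((f \o g) u) ((f \o g) v) <-> adj u v.
Proof. exact: iff_trans (aut_adj f _ _) (aut_adj g u v). Qed.

Definition aut_mul (f g : graph_aut X) : graph_aut X :=
  GraphAut (bij_comp (aut_bij f) (aut_bij g)) (aut_mul_adj f g).

Lemma aut_inverse (f : graph_aut X) :
  {g : X -> X | cancel f g & cancel g f}.
Proof. by apply: cid2; case: (aut_bij f) => g fg gf; exists g. Qed.

Definition aut_inv_fun (f : graph_aut X) : X -> X := s2val (aut_inverse f).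

Lemma aut_invK (f : graph_aut X) : cancel f (aut_inv_fun f).
Proof. by rewrite /aut_inv_fun; case: (aut_inverse f). Qed.

Lemma aut_invKr (f : graph_aut X) : cancel (aut_inv_fun f) f.
Proof. by rewrite /aut_inv_fun; case: (aut_inverse f). Qed.

Lemma aut_inv_adj (f : graph_aut X) (u v : X) :
  adj (aut_inv_fun f u) (aut_inv_fun f v) <-> adj u v.
Proof. by rewrite -(aut_adj f) !aut_invKr. Qed.

Definition aut_inv (f : graph_aut X) : graph_aut X :=
  GraphAut (Bijective (aut_invKr f) (aut_invK f)) (@aut_inv_adj f).

Lemma aut_mulA : associative aut_mul.
Proof. by move=> f g h; apply: graph_aut_inj. Qed.

Lemma aut_mul1 : left_id aut_one aut_mul.
Proof. by move=> f; apply: graph_aut_inj. Qed.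

Lemma aut_mulr1 : right_id aut_one aut_mul.
Proof. by move=> f; apply: graph_aut_inj. Qed.

Lemma aut_mulV : left_inverse aut_one aut_inv aut_mul.
Proof. by move=> f; apply: graph_aut_inj => u; apply: aut_invK. Qed.

Lemma aut_mulrV : right_inverse aut_one aut_inv aut_mul.
Proof. by move=> f; apply: graph_aut_inj => u; apply: aut_invKr. Qed.

HB.instance Definition _ := isGroup.Build (graph_aut X)
  aut_mulA aut_mul1 aut_mulr1 aut_mulV aut_mulrV.

End AutGroup.

Definition Aut_graph (X : graph) : groupType := graph_aut X.

Definition isomorphic_groups (G H : groupType) : Prop :=
  exists phi : {multiplicative G -> H}, bijective phi.

Local Open Scope ring_scope.

(* A sequence x_1 x_2 ... is a function w : nat -> bool with w i = x_{i+1}. *)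
Definition zeros : nat -> bool := fun=> false.

Definition cofinal (w w' : nat -> bool) : Prop :=
  exists i0, forall i, (i0 <= i)%N -> w i = w' i.

Definition anticofinal (w w' : nat -> bool) : Prop :=
  exists i0, forall i, (i0 <= i)%N -> w i = ~~ w' i.

(* Only meaningful for 1 <= n. *)
Definition a_ (w : nat -> bool) (n : nat) : int :=
  \sum_(i < n) (w i)%:R * 2 ^+ i - 2 ^+ n.-1.

Definition E_ (w : nat -> bool) (n : nat) (u v : int) : Prop :=
  if n is 0 then exists z : int, u = z /\ v = z + 1
  else exists z : int, u = 2 ^+ n * z - a_ w n /\ v = 2 ^+ n * (z + 1) - a_ w n.

Definition loop_vertex (w : nat -> bool) (v : int) : Prop :=
  forall n u u', (1 <= n)%N -> E_ w n u u' -> v <> u /\ v <> u'.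

(* The edges of E_ w n join integers at distance 2 ^ n, so edges taken from
   different E_ w n are never parallel and an adjacency relation loses nothing. *)
Definition X_adj (w : nat -> bool) (u v : int) : Prop :=
  (exists n, E_ w n u v \/ E_ w n v u) \/ (u = v /\ loop_vertex w u).

Lemma X_adj_sym w u v : X_adj w u v -> X_adj w v u.
Proof.
case=> [[n Euv]|[<- loop_u]]; last by right.
by left; exists n; case: Euv; [right|left].
Qed.

Definition X_ (w : nat -> bool) : graph := Graph (@X_adj_sym w).

(* Main.v *)
Require Import Defs.
From mathcomp Require Import all_boot all_order all_algebra all_fingroup.
From HB Require Import structures.
From mathcomp Require Import zify ring boolp.

(* Read w as a 2-adic integer and give u the valuation n of u + w: the edges of
   X_w join u to u + 1 and to u + 2^(n+1), n being common to both ends of the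
   latter.  The triangles are the {u - 1, u, u + 1} with u + w even, so an
   automorphism preserves the parity of u + w and the edges of length 1; hence
   it has the form u |-> c + u or u |-> c - u.  It also preserves every
   valuation.  This forces c = 0 in the first case, and in the second c = -2w,
   so that w is an integer, i.e. the sequence w is eventually constant. *)

Set Implicit Arguments.
Unset Strict Implicit.
Unset Printing Implicit Defensive.

Import GRing.Theory Num.Theory.

Local Open Scope ring_scope.

(** * Groups of order two and divisibility by every power of 2 *)

Lemma two_elements_isomorphic_Z2 (G : groupType) (r : G) :
  r <> 1%g -> (forall g : G, g = 1%g \/ g = r) -> isomorphic_groups G 'Z_2.
Proof.
move=> r1 Gr; have rr : (r * r = 1)%g.
  by case: (Gr (r * r)%g) => // rr; case: r1; rewrite -(mulKg r r) rr mulVg.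
have r1b : (r == 1%g) = false by apply/eqP.
pose phi (g : G) : 'Z_2 := if g == 1%g then 0%R else 1%R.
have phiM : {morph phi : x y / (x * y)%g >-> (x * y)%g}.
  move=> x y; apply/val_inj; rewrite /phi.
  by case: (Gr x) => ->; case: (Gr y) => ->; rewrite ?mul1g ?mulg1 ?rr ?eqxx ?r1b.
pose m := isMultiplicative.Build G 'Z_2 phi phiM.
pose phi' : {multiplicative G -> 'Z_2} := HB.pack phi m.
exists phi'; exists (fun i : 'Z_2 => if i == 0 then 1%g else r) => [g|i].
  by rewrite /= /phi; case: (Gr g) => ->; rewrite ?eqxx ?r1b.
rewrite /= /phi.
case: i => [[|[|//]]] Hi; rewrite /= ?eqxx ?r1b; exact/val_inj.
Qed.

Lemma exp2_dvd_all_eq0 (c : int) : (forall n, (2 ^+ n %| c)%Z) -> c = 0.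
Proof.
move=> /(_ `|c|%N); rewrite dvdzE abszX /= => dv; apply/eqP.
rewrite -absz_eq0; apply: contraT; rewrite -lt0n => /dvdn_leq/(_ dv).
by rewrite leqNgt ltn_expl.
Qed.

Lemma ltz_exp2 (n : nat) : n%:Z < 2 ^+ n.
Proof. by rewrite -[2]/(2%:R : int) -natrX natz ltz_nat ltn_expl. Qed.

(** * Valuations of vertices and adjacency in terms of them *)

Section Graph.
Variable w : nat -> bool.

(** The residue modulo [2 ^+ n] of the 2-adic integer [w]. *)
Definition psum (n : nat) : int := \sum_(i < n) (w i)%:R * 2 ^+ i.

(* [u + w] has 2-adic valuation [n], with [w] read as a 2-adic integer. *)
Definition level (n : nat) (u : int) : bool := (2 ^+ n.+1 %| u + a_ w n.+1)%Z.

Lemma psumS n : psum n.+1 = psum n + (w n)%:R * 2 ^+ n.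
Proof. by rewrite /psum big_ord_recr. Qed.

Lemma a_S n : a_ w n.+1 = psum n.+1 - 2 ^+ n.
Proof. by []. Qed.

Lemma psum_bounds n : 0 <= psum n < 2 ^+ n.
Proof.
elim: n => [|n IHn]; first by rewrite /psum big_ord0.
rewrite psumS exprS; case: (w n); lia.
Qed.

Lemma psum_mod m n : (n <= m)%N -> (2 ^+ n %| psum m - psum n)%Z.
Proof.
elim: m => [|m IHm]; first by rewrite leqn0 => /eqP ->; rewrite subrr dvdz0.
rewrite leq_eqVlt => /predU1P[->|]; first by rewrite subrr dvdz0.
rewrite ltnS => nm; rewrite psumS addrAC rpredD ?IHm //.
by rewrite dvdz_mull // dvdz_exp2l.
Qed.

(** Two levels [n < m] at [u] would make [2 ^+ n.+1] divide [2 ^+ n], the term subtracted in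
    [a_ w n.+1]. *)
Lemma level_lt_false n m u : (n < m)%N -> level n u -> ~~ level m u.
Proof.
move=> nm Ln; apply/negP => Lm.
have d1 : (2 ^+ n.+1 %| u + a_ w m.+1)%Z by apply: dvdz_trans Lm; apply: dvdz_exp2l; lia.
have d2 := @psum_mod m.+1 n.+1 (ltnW nm).
have d3 : (2 ^+ n.+1 %| (2 : int) ^+ m)%Z by apply: dvdz_exp2l.
have : (2 ^+ n.+1 %| (2 : int) ^+ n)%Z.
  have -> : (2 : int) ^+ n = (u + a_ w m.+1) - (u + a_ w n.+1)
       - (psum m.+1 - psum n.+1) + 2 ^+ m by rewrite !a_S; ring.
  exact: rpredD (rpredB (rpredB d1 Ln) d2) d3.
by rewrite dvdz_Pexp2l // ltnn.
Qed.

Lemma level_inj n m u : level n u -> level m u -> n = m.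
Proof.
case: (ltngtP n m) => // lt Ln Lm.
  by have := level_lt_false lt Ln; rewrite Lm.
by have := level_lt_false lt Lm; rewrite Ln.
Qed.

Lemma level_congr n u v : (2 ^+ n.+1 %| v - u)%Z -> level n v = level n u.
Proof. by move=> d; rewrite /level -[v](subrK u) -[in LHS]addrA rpredDl. Qed.

Lemma levelD n u : level n (u + 2 ^+ n.+1) = level n u.
Proof. by apply: level_congr; rewrite addrC addKr. Qed.

Lemma level_Na n : level n (- a_ w n.+1).
Proof. by rewrite /level addNr dvdz0. Qed.

Lemma level0S u : level 0 (u + 1) = ~~ level 0 u.
Proof. by rewrite /level expr1; lia. Qed.

Lemma E_levelE n u v : E_ w n.+1 u v <-> level n u /\ v = u + 2 ^+ n.+1.
Proof.
split=> [[z [-> ->]]|[/dvdzP [z uz] ->]].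
  by split; [apply/dvdzP; exists z|]; ring.
by exists z; split; rewrite [_ ^+ _ * _]mulrC ?mulrDl -uz; ring.
Qed.

(** The loop sits where [u + w] has no finite valuation, that is, at [u = -w] when [w] is an
    integer. *)
Lemma loop_vertexE u : loop_vertex w u <-> forall n, ~~ level n u.
Proof.
split=> [lu n|lu [//|n] v v' _ /E_levelE [Lv ->]].
  apply/negP => Lu; have [] // := lu n.+1 u (u + 2 ^+ n.+1) isT.
  exact/E_levelE.
split=> uv; have := lu n; rewrite uv ?levelD ?Lv //.
Qed.

Lemma X_adjE u v : X_adj w u v <->
  [\/ `|u - v| = 1,
      exists2 n, level n u & `|u - v| = 2 ^+ n.+1 |
      u = v /\ forall n, ~~ level n u].
Proof.
rewrite /X_adj loop_vertexE; split.
  case=> [[[|n] e]|]; last by constructor 3.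
    by constructor 1; case: e => [[z]|[z]]; lia.
  have norm2 := ger0_norm (exprn_ge0 n.+1 (isT : 0 <= 2 :> int)).
  by constructor 2; exists n; case: e => /E_levelE [Ln e]; rewrite ?e ?levelD //
    ?opprD ?addNKr ?normrN ?norm2 // addrC addKr norm2.
case=> [d|[n Ln d]|]; last by right.
  left; exists 0%N; have [e|e] : v = u + 1 \/ u = v + 1 by lia.
    by left; exists u.
  by right; exists v.
left; exists n.+1; have [e|e] : v = u + 2 ^+ n.+1 \/ u = v + 2 ^+ n.+1 by lia.
  by left; apply/E_levelE.
by right; apply/E_levelE; split=> //; rewrite -levelD -e.
Qed.

(** Edge lengths are distinct powers of 2, so the length of an edge determines the level of its
    ends. *)
Lemma X_adj_level n u v : X_adj w u v -> `|u - v| = 2 ^+ n.+1 -> level n u.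
Proof.
have g := exprn_gt0 n (isT : 0 < 2 :> int).
have E : (2 : int) ^+ n.+1 = 2 * 2 ^+ n by rewrite exprS.
case/X_adjE => [-> |[m Lm ->]|[-> _]] d; [lia| |lia].
have /eqP := congr1 absz d; rewrite !abszX eqn_exp2l // => /eqP [<-] //.
Qed.

(** * Triangles, and level 0 as a graph invariant *)

(* Unlike [X_adj], this relation only sees the edges of length 1 and 2: the
   triangles of [X_ w] are the [{u - 1, u, u + 1}] with [u] not of level 0. *)
Definition triangle_edge (u v : int) : Prop :=
  exists x, [/\ X_adj w u v, X_adj w x u, X_adj w x v & [/\ u <> v, x <> u & x <> v]].

(** An edge of length [L = 2 ^+ n.+2] lies in no triangle: both ends have level [n.+1], so the other
    two sides would have length 1 or [L], and with [L >= 4] no such triple of distances closes up on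
    a line. *)
Lemma triangle_edgeE u v :
  triangle_edge u v <-> `|u - v| = 1 \/ level 0 u /\ `|u - v| = 2.
Proof.
split.
  case=> x [/X_adjE Auv /X_adjE Axu /X_adjE Axv [nuv nxu nxv]].
  case: Auv => [|[[|n] Ln d]|[//]]; [by left|by right; rewrite d|exfalso].
  have Lv : level n.+1 v.
    have [->|->] : v = u + 2 ^+ n.+2 \/ v = u - 2 ^+ n.+2 by lia.
      by rewrite levelD.
    by rewrite -levelD subrK.
  have other y : level n.+1 y -> x <> y ->
      [\/ `|x - y| = 1, exists2 n, level n x & `|x - y| = 2 ^+ n.+1 |
      x = y /\ forall n, ~~ level n x] -> `|x - y| = 1 \/ `|x - y| = 2 ^+ n.+2.
    move=> Ly nxy [|[m Lm dm]|[]//]; [by left|right].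
    suff Lmy : level m y by rewrite dm (level_inj Lmy Ly).
    have [->|->] : y = x + 2 ^+ m.+1 \/ y = x - 2 ^+ m.+1 by lia.
      by rewrite levelD.
    by rewrite -levelD subrK.
  have := other u Ln nxu Axu; have := other v Lv nxv Axv.
  have g := exprn_gt0 n (isT : 0 < 2 :> int).
  have E : (2 : int) ^+ n.+2 = 4 * 2 ^+ n by rewrite !exprS mulrA.
  by rewrite E in d *; lia.
have adj1 y z : `|y - z| = 1 -> X_adj w y z by move=> ?; apply/X_adjE; constructor 1.
have adj2 y z : level 0 y -> `|y - z| = 2 -> X_adj w y z.
  by move=> ? ?; apply/X_adjE; constructor 2; exists 0%N.
case=> [d|[L d]].
  (* The third vertex is the mirror image of the level 0 end in the other end. *)
  have [L|L] : level 0 u \/ level 0 v.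
    have [->|->] : v = u + 1 \/ u = v + 1 by lia.
      by rewrite level0S; case: level; [left|right].
    by rewrite level0S; case: level; [right|left].
    exists (2 * v - u).
    split; [exact: adj1|apply/X_adj_sym; apply: adj2 => //; lia
      |apply: adj1; lia|split; lia].
  exists (2 * u - v).
  split; [exact: adj1|apply: adj1; lia
     |apply/X_adj_sym; apply: adj2 => //; lia|split; lia].
have [e ue] : exists e, v = u + 2 * e by exists ((v - u) %/ 2)%Z; lia.
exists (u + e); split; [exact: adj2|apply: adj1; lia|apply: adj1; lia|split; lia].
Qed.

(** Level 0 vertices meet four triangle edges (to distance 1 and 2 on each side), the others only
    two; asking for three separates them. *)
Lemma level0_triangle_edges u : level 0 u <->
  exists x y z, [/\ triangle_edge u x, triangle_edge u y, triangle_edge u z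
                  & [/\ x <> y, y <> z & x <> z]].
Proof.
split=> [L|[x [y [z []]]]].
  exists (u + 1), (u - 1), (u + 2).
  by split; [apply/triangle_edgeE; lia..|split; lia].
by move=> /triangle_edgeE + /triangle_edgeE + /triangle_edgeE + []; case: level; lia.
Qed.

(** * Shape of an arbitrary automorphism *)

Lemma aut_neq (f : graph_aut (X_ w)) (u v : int) : u <> v -> f u <> f v.
Proof. by move=> uv /(bij_inj (aut_bij f)). Qed.

Lemma aut_triangle_edge (f : graph_aut (X_ w)) (u v : int) :
  triangle_edge u v -> triangle_edge (f u) (f v).
Proof.
case=> x [? ? ? [? ? ?]]; exists (f x : int).
by split; try exact/(aut_adj f); split; exact: aut_neq.
Qed.

Lemma aut_level0_imp (f : graph_aut (X_ w)) (u : int) : level 0 u -> level 0 (f u).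
Proof.
move/level0_triangle_edges => [x [y [z [? ? ? [? ? ?]]]]].
apply/level0_triangle_edges; exists (f x : int), (f y : int), (f z : int).
by split; try exact: aut_triangle_edge; split; exact: aut_neq.
Qed.

Section Automorphism.
Variable f : graph_aut (X_ w).

Lemma aut_level0 (u : int) : level 0 (f u) = level 0 u.
Proof.
apply/idP/idP => [|/aut_level0_imp//].
by move/(aut_level0_imp (aut_inv f)) => /=; rewrite aut_invK.
Qed.

(** The image is a triangle edge, and length 2 is excluded because exactly one of [u], [u + 1] has
    level 0. *)
Lemma aut_unit_edge (u : int) : `|(f (u + 1 : int) : int) - (f u : int)| = 1.
Proof.
have /aut_triangle_edge-/(_ f)/triangle_edgeE : triangle_edge u (u + 1).
  by apply/triangle_edgeE; lia.
have := level0S u; have := aut_level0 u; have := aut_level0 (u + 1).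
move: (f u : int) (f (u + 1 : int) : int) => a b /= <- <- S.
case=> [|[La d]]; first lia.
move: S; have [->|->] : b = a + 1 + 1 \/ a = b + 1 + 1 by lia.
  by rewrite !level0S; case: level.
by rewrite !level0S; case: level.
Qed.

Lemma aut_affine : exists e c : int, `|e| = 1 /\ forall u : int, f u = e * u + c :> int.
Proof.
pose d (u : int) : int := (f (u + 1 : int) : int) - (f u : int).
(* Increments are 1 or -1, and a change of sign would give [f (u + 2) = f u]. *)
have dS u : d (u + 1) = d u.
  have := aut_unit_edge u; have := aut_unit_edge (u + 1).
  have : f (u + 1 + 1 : int) <> f u by apply: aut_neq; lia.
  rewrite /d; set a := f u; set b := f _; set c := f _; move: a b c => /= a b c; lia.
have d0 u : d u = d 0.
  elim/int_ind: u => [//|n <-|n <-]; first by rewrite -addn1 PoszD dS.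
  by rewrite -[LHS]dS -addn1 PoszD opprD subrK.
exists (d 0), (f (0 : int)); split; first exact: aut_unit_edge.
have step (u : int) : f (u + 1 : int) = d 0 + f u :> int by rewrite -(d0 u) /d subrK.
move: (d 0) step => e step.
elim/int_ind => [|n IH|n IH]; first by rewrite mulr0 add0r.
  by rewrite -addn1 PoszD step IH mulrDr mulr1 addrCA addrA.
have := step (- n.+1%:Z); rewrite -addn1 PoszD opprD subrK IH.
by move=> H; rewrite -[LHS](addKr e) -H mulrDr mulrN1 addrA [- e + _]addrC.
Qed.

(** An affine map of slope 1 or -1 preserves the length of the edge from [u] to [u + 2 ^+ n.+1], and
    this length reveals the level. *)
Lemma aut_level n (u : int) : level n u -> level n (f u).
Proof.
move=> L; have [e [c [e1 fe]]] := aut_affine.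
have A : X_adj w u (u + 2 ^+ n.+1).
  apply/X_adjE; constructor 2; exists n => //.
  by rewrite opprD addNKr normrN ger0_norm // exprn_ge0.
apply: (@X_adj_level _ _ (f (u + 2 ^+ n.+1 : int))); first exact/(aut_adj f).
rewrite !fe.
have -> : e * u + c - (e * (u + 2 ^+ n.+1) + c) = - (e * 2 ^+ n.+1) by ring.
by rewrite normrN normrM e1 mul1r ger0_norm // exprn_ge0.
Qed.

Lemma aut_id_or_reflection : (forall u : int, f u = u :> int) \/
  exists2 d : int, (forall u : int, f u = d *+ 2 - u :> int)
    & forall n, (2 ^+ n %| psum n + d)%Z.
Proof.
have [e [c [e1 fe]]] := aut_affine.
(* The vertex [- a_ w n.+1] has level [n]; its image having the same level is a congruence on [c]
   modulo [2 ^+ n.+1]. *)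
have fa n : level n (e * - a_ w n.+1 + c) by rewrite -fe aut_level ?level_Na.
have [ee|ee] : e = 1 \/ e = -1 by lia.
  have c0 : c = 0.
    apply: exp2_dvd_all_eq0 => n; have := fa n.
    rewrite /level ee mul1r addrAC addNr add0r; apply: dvdz_trans; exact: dvdz_exp2l.
  by left=> u; rewrite fe ee c0 mul1r addr0.
have dc n : (2 ^+ n.+1 %| psum n.+1 *+ 2 + c)%Z.
  have := fa n; rewrite /level ee a_S.
  have -> : -1 * - (psum n.+1 - 2 ^+ n) + c + (psum n.+1 - 2 ^+ n)
     = psum n.+1 *+ 2 + c - 2 ^+ n.+1 by rewrite exprS; ring.
  by rewrite rpredBr.
have [d cd] : exists d, c = d *+ 2.
  have := dc 0%N; rewrite expr1 => H; exists (c %/ 2)%Z; lia.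
right; exists d => [u|n]; first by rewrite fe ee cd; ring.
suff : (2 ^+ n %| psum n.+1 + d)%Z.
  by rewrite psumS addrAC rpredDr // dvdz_mull.
by have := dc n; rewrite cd -mulrnDl -[(_ + _) *+ 2]mulr_natl exprS dvdz_mul2l.
Qed.

End Automorphism.

(** * Sequences whose 2-adic value is an integer [-d] *)

Lemma cofinal_psum : cofinal w zeros \/ anticofinal w zeros <->
  exists d, forall n, (2 ^+ n %| psum n + d)%Z.
Proof.
split.
  (* The congruence at [N] reduces to those at smaller [n], so only [n >= N] matters. *)
  have down N d : (forall n, (N <= n)%N -> (2 ^+ n %| psum n + d)%Z) ->
      forall n, (2 ^+ n %| psum n + d)%Z.
    move=> H n; have [/H//|/ltnW nN] := leqP N n.
    have -> : psum n + d = (psum N + d) - (psum N - psum n) by ring.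
    rewrite rpredB ?psum_mod //; apply: dvdz_trans (H N (leqnn N)); exact: dvdz_exp2l.
  case=> [[N HN]|[N HN]].
    exists (- psum N); apply: (down N) => n Nn.
    suff -> : psum n = psum N by rewrite subrr dvdz0.
    elim: n Nn => [|n IH]; first by rewrite leqn0 => /eqP ->.
    rewrite leq_eqVlt => /predU1P[->//|Nn].
    by rewrite psumS IH // HN // mul0r addr0.
  (* Ones in positions [N] to [n - 1] contribute [2 ^+ n - 2 ^+ N], so 2-adically [w] equals
     [psum N - 2 ^+ N]. *)
  exists (2 ^+ N - psum N); apply: (down N) => n Nn.
  suff -> : psum n = psum N + (2 ^+ n - 2 ^+ N).
    by rewrite [X in (_ %| X)%Z](_ : _ = 2 ^+ n) ?dvdzz //; ring.
  elim: n Nn => [|n IH]; first by rewrite leqn0 => /eqP ->; rewrite subrr addr0.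
  rewrite leq_eqVlt => /predU1P[->|Nn]; first by rewrite subrr addr0.
  by rewrite psumS IH // HN //= exprS; ring.
case=> d dv.
have big n : (`|d| <= n)%N -> `|d| < 2 ^+ n.
  by move=> dn; have := ltz_exp2 n; lia.
(* For [m >= |d|], [psum m + d] lies strictly between [- 2 ^+ m] and [2 ^+ m] if [d <= 0], and
   strictly between 0 and [2 ^+ m.+1] if [d > 0]. Hence it is 0 or [2 ^+ m] respectively, and
   consecutive differences of [psum] give the digits. *)
have [d0|d0] := lerP d 0.
  left; exists `|d|%N => n dn; rewrite /zeros.
  have E m : (`|d| <= m)%N -> psum m = - d.
    move=> /big b; have := psum_bounds m; have /dvdzP [q] := dv m.
    have : q <= -1 \/ q = 0 \/ q >= 1 by lia.
    case=> [q0|[->|q0]]; nia.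
  have := psumS n; rewrite !E //; last by lia.
  by have := exprn_gt0 n (isT : 0 < 2 :> int); case: (w n) => //; lia.
right; exists `|d|%N => n dn; rewrite /zeros.
have E m : (`|d| <= m)%N -> psum m = 2 ^+ m - d.
  move=> /big b; have := psum_bounds m; have /dvdzP [q] := dv m.
  have : q <= 0 \/ q = 1 \/ q >= 2 by lia.
  case=> [q0|[->|q0]]; nia.
have := psumS n; rewrite !E //; last by lia.
by rewrite exprS; have := exprn_gt0 n (isT : 0 < 2 :> int); case: (w n) => //; lia.
Qed.

(** * The reflection about the integer [d = -w] *)

Section Reflection.
Variable d : int.
Hypothesis dP : forall n, (2 ^+ n %| psum n + d)%Z.

(** As [w = -d], the reflection replaces [u + w] by its negative, which has the same valuation. *)
Lemma level_reflection n u : level n (d *+ 2 - u) = level n u.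
Proof.
rewrite /level a_S -rpredN.
have -> : - (d *+ 2 - u + (psum n.+1 - 2 ^+ n)) =
  (u + (psum n.+1 - 2 ^+ n)) - (psum n.+1 + d) *+ 2 + 2 ^+ n.+1.
  by rewrite exprS; ring.
by rewrite rpredDr // rpredBr // rpredMn.
Qed.

Lemma reflectionK : involutive (fun u : X_ w => d *+ 2 - u : int).
Proof. by move=> u; rewrite opprB addrC subrK. Qed.

Lemma X_adj_reflection_imp u v : X_adj w u v -> X_adj w (d *+ 2 - u) (d *+ 2 - v).
Proof.
have E : `|d *+ 2 - u - (d *+ 2 - v)| = `|u - v| by rewrite -normrN; congr (`|_|); ring.
rewrite !X_adjE E; case=> [?|[n L ?]|[<- L]]; [by constructor 1| |].
  by constructor 2; exists n; rewrite ?level_reflection.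
by constructor 3; split=> // n; rewrite level_reflection.
Qed.

Lemma X_adj_reflection (u v : X_ w) :
  @adj (X_ w) (d *+ 2 - u : int) (d *+ 2 - v : int) <-> adj u v.
Proof.
split; last exact: X_adj_reflection_imp.
by move/X_adj_reflection_imp; rewrite (reflectionK u) (reflectionK v).
Qed.

Definition reflection : graph_aut (X_ w) :=
  GraphAut (inv_bij reflectionK) X_adj_reflection.

End Reflection.

End Graph.

(* 'Z_2 as a groupType is the additive group of the integers mod 2. *)
Theorem corollary2 (w : nat -> bool) :
  (cofinal w zeros \/ anticofinal w zeros ->
     isomorphic_groups (Aut_graph (X_ w)) 'Z_2) /\
  (~ (cofinal w zeros \/ anticofinal w zeros) ->
     forall f : Aut_graph (X_ w), f = 1%g).
Proof.
split=> [/cofinal_psum [d dP]|wN f]; last first.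
  apply: graph_aut_inj; case: (aut_id_or_reflection f) => [//|[d _ dP]].
  by case: wN; apply/cofinal_psum; exists d.
apply: (@two_elements_isomorphic_Z2 _ (reflection dP : Aut_graph (X_ w))).
  (* The reflection fixes [d], so it is tested at [d + 1], which it sends to [d - 1]. *)
  move=> r1; have /= := congr1 (fun f : graph_aut (X_ w) => f (d + 1 : int) : int) r1; lia.
move=> f; case: (aut_id_or_reflection f) => [fid|[d' fd dP']].
  by left; apply: graph_aut_inj.
right; apply: graph_aut_inj => u /=; rewrite fd.
(* Both centres are congruent to [- psum w n] modulo [2 ^+ n] for every [n]. *)
suff -> : d' = d by [].
apply/eqP; rewrite -subr_eq0; apply/eqP/exp2_dvd_all_eq0 => n.
have -> : d' - d = (psum w n + d') - (psum w n + d) by ring.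
exact: rpredB.
Qed.
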